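(* Let $0<\beta<1$ and $\alpha,p,\lambda>0$. Then the processes $\{N(\Gamma(E_\beta(t)),\lambda)\}_{t\ge0}$ and $\{Q_\beta(t,\lambda)\}_{t\ge0}$ are different, i.e. they do not have the same finite-dimensional distributions.
   Context: $\{N(t,\lambda)\}_{t\ge0}$ is a Poisson process of rate $\lambda$; $\{\Gamma(t)\}_{t\ge0}$ is the gamma subordinator with $\Gamma(t)\sim G(\alpha,pt)$, i.e. with density $\frac{\alpha^{pt}}{\Gamma(pt)}y^{pt-1}e^{-\alpha y}$, $y>0$; $E_\beta(t)=\inf\{s>0:D_\beta(s)>t\}$ is the inverse of the $\beta$-stable subordinator $D_\beta$, $\mathbb{E}[e^{-sD_\beta(t)}]=e^{-ts^\beta}$. The processes $N$, $\Gamma$, $E_\beta$ are mutually independent. The fractional negative binomial process is $Q_\beta(t,\lambda)=N_\beta(\Gamma(t),\lambda)$, where $N_\beta(t,\lambda)=N(E_\beta(t),\lambda)$ is the fractional Poisson process; thus $Q_\beta(t,\lambda)=N(E_\beta(\Gamma(t)),\lambda)$. *)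

(* Defs.v *)
From HB Require Import structures.
From mathcomp Require Import all_boot all_order all_algebra finmap.
From mathcomp Require Import all_classical all_reals all_analysis.
Set Implicit Arguments.
Unset Strict Implicit.
Unset Printing Implicit Defensive.
Import Order.TTheory GRing.Theory Num.Theory.
Import numFieldNormedType.Exports.
Local Open Scope classical_set_scope.
Local Open Scope ring_scope.

(* A process indexed by [0, +oo[ is a function of a real time parameter; its
   values at negative times are never constrained nor used. *)

Definition independent_systems d (T : measurableType d) (R : realType)
    (P : probability T R) (I : choiceType) (F : I -> set (set T)) : Prop :=
  forall (J : {fset I}) (A : I -> set T), (forall i, i \in J -> F i (A i)) ->
    P (\bigcap_(i in [set` J]) A i) = (\prod_(i <- J) P (A i))%E.

Definition independent_RVs d d' (T : measurableType d) (V : measurableType d')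
    (R : realType) (P : probability T R) (I : choiceType) (X : I -> T -> V) :
    Prop :=
  independent_systems P (fun i => preimage_set_system setT (X i) measurable).

Definition process_sigma d d' (T : measurableType d) (V : measurableType d')
    (R : realType) (X : R -> T -> V) : set (set T) :=
  <<s \bigcup_(t in [set t : R | 0 <= t])
        preimage_set_system setT (X t) measurable >>.

(* Any n, any t_1, ..., t_n >= 0, any set B of the product sigma-algebra. *)
Definition same_fdd d d' (T : measurableType d) (V : measurableType d')
    (R : realType) (P : probability T R) (X Y : R -> T -> V) : Prop :=
  forall (n : nat) (t : 'I_n -> R), (forall i, 0 <= t i) ->
  forall B : set (n.-tuple V), measurable B ->
    pushforward P (fun w => [tuple X (t i) w | i < n]) B =
    pushforward P (fun w => [tuple Y (t i) w | i < n]) B.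

Definition time_change (T V : Type) (R : realType)
    (X : R -> T -> V) (S : R -> T -> R) : R -> T -> V :=
  fun t w => X (S t w) w.

Record levy_process d (T : measurableType d) (R : realType)
    (P : probability T R) (X : R -> T -> R) : Prop := LevyProcess {
  levy_measurable : forall t : R, 0 <= t -> measurable_fun setT (X t) ;
  levy_start : forall w, X 0 w = 0 ;
  levy_right_continuous : forall (w : T) (t : R), 0 <= t -> X ^~ w @ t^'+ --> X t w ;
  levy_left_limits : forall (w : T) (t : R), 0 < t -> cvg (X ^~ w @ t^'-) ;
  levy_independent_increments : forall t : nat -> R, 0 <= t 0%N ->
    (forall i, t i <= t i.+1) ->
    independent_RVs P (fun i w => X (t i.+1) w - X (t i) w) ;
  levy_stationary_increments : forall s t : R, 0 <= s <= t ->
    forall B : set R, measurable B ->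
    pushforward P (fun w => X t w - X s w) B = pushforward P (X (t - s)) B }.

Record subordinator d (T : measurableType d) (R : realType)
    (P : probability T R) (X : R -> T -> R) : Prop := Subordinator {
  subordinator_levy : levy_process P X ;
  subordinator_nondecreasing : forall (w : T) (s t : R), 0 <= s <= t -> X s w <= X t w }.

Record poisson_process d (T : measurableType d) (R : realType)
    (P : probability T R) (lambda : R) (N : R -> T -> nat) : Prop :=
  PoissonProcess {
  poisson_levy : levy_process P (fun t w => (N t w)%:R) ;
  poisson_marginal : forall t : R, 0 < t -> forall B : set nat,
    pushforward P (N t) B = poisson_prob (lambda * t) 0%N B }.

Definition gamma_fun (R : realType) (a : R) : R :=
  \int[lebesgue_measure]_(x in `]0, +oo[) (x `^ (a - 1) * expR (- x)).

Definition gamma_pdf (R : realType) (rate shape y : R) : R :=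
  rate `^ shape / gamma_fun shape * y `^ (shape - 1) * expR (- (rate * y)).

Definition gamma_prob (R : realType) (rate shape : R) (B : set R) : \bar R :=
  (\int[lebesgue_measure]_(y in B `&` `]0%R, +oo[)
     (gamma_pdf rate shape y)%:E)%E.

Record gamma_subordinator d (T : measurableType d) (R : realType)
    (P : probability T R) (alpha p : R) (G : R -> T -> R) : Prop :=
  GammaSubordinator {
  gamma_is_subordinator : subordinator P G ;
  gamma_marginal : forall t : R, 0 < t -> forall B : set R, measurable B ->
    pushforward P (G t) B = gamma_prob alpha (p * t) B }.

Record stable_subordinator d (T : measurableType d) (R : realType)
    (P : probability T R) (beta : R) (D : R -> T -> R) : Prop :=
  StableSubordinator {
  stable_is_subordinator : subordinator P D ;
  stable_laplace : forall s t : R, 0 <= s -> 0 <= t ->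
    'E_P[fun w => expR (- (s * D t w))]%E = (expR (- (t * s `^ beta)))%:E }.

(* [inf] is 0 on the empty set; this concerns only the paths of D bounded by t,
   which form a null event for a stable subordinator. *)
Definition inverse_process (T : Type) (R : realType) (D : R -> T -> R) :
    R -> T -> R :=
  fun t w => inf [set s : R | 0 < s /\ t < D s w].

Definition fractional_poisson (T : Type) (R : realType)
    (N : R -> T -> nat) (D : R -> T -> R) : R -> T -> nat :=
  time_change N (inverse_process D).

Definition fractional_negative_binomial (T : Type) (R : realType)
    (N : R -> T -> nat) (G D : R -> T -> R) : R -> T -> nat :=
  time_change (fractional_poisson N D) G.

(* Main.v *)
Require Import Defs.
From mathcomp Require Import all_boot all_order all_algebra finmap.
From mathcomp Require Import all_classical all_reals all_analysis.
From mathcomp Require Import measurable_realfun ring lra.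
Set Implicit Arguments.
Unset Strict Implicit.
Unset Printing Implicit Defensive.
Import Order.TTheory GRing.Theory Num.Theory.
Import numFieldNormedType.Exports.
Local Open Scope classical_set_scope.
Local Open Scope ring_scope.

(** At small times the two processes leave 0 at different speeds, so already
    their one-dimensional distributions differ. Write E for the inverse of the
    stable subordinator D. By self-similarity E(t) is of order t^beta, which is
    much larger than t when t is small, since beta < 1. It therefore matters
    whether the gamma process runs for the time E(t) or for the time t.

    - N(Gamma(E(t))). With probability bounded below, E(t) >= a, where
      a = t^beta / 4. With probability at least of order a, Gamma(a) >= 1, as
      one large jump suffices; and N(1) > 0 has a fixed positive probability.
      These three events are independent and force N(Gamma(E(t))) > 0, so that
      P(N(Gamma(E(t))) > 0) >= k t^beta with k > 0 ([P_N_G_E_ge]).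
    - N(E(Gamma(t))). Here the gamma clock runs first and only over a time t:
      Gamma(t) exceeds u = t^2 with probability O(t ln(1/t)). If it does not,
      then E(Gamma(t)) <= r unless D(r) <= u, and N(r) = 0 up to probability
      lambda r. For r = t^(3 beta / 2) the event D(r) <= u has probability
      at most exp(1 - t^(-beta / 2)). Altogether
      P(N(E(Gamma(t))) > 0) = o(t^beta) ([P_N_E_G_le], [upper_bound_le]).

    Both bounds use only events that depend on one process at a fixed time, so
    no integral over the law of a random clock occurs. The laws enter
    through a Chernoff bound on the Laplace transform of D(r) and through the
    gamma density of shape x = p t, whose normalising constant is comparable
    to x as x tends to 0; this comparison is read off from the total mass 1 of
    the density, by comparing it with y^(x - 1) near 0.

    Two facts about paths make the argument rigorous. The time-changed
    processes are measurable, because right-continuous processes are limits of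
    their evaluations on finer and finer grids; and the Poisson process is
    almost surely nondecreasing, because it is so on rational times. *)

(** * Paths: measurability of time changes and monotonicity *)

Lemma measurable_gt_level d (T : measurableType d) (R : realType) (X : T -> R)
  (c : R) : measurable_fun setT X -> measurable [set w | c < X w].
Proof.
move=> /(_ measurableT [set` `]c, +oo[] (measurable_itv _)).
by rewrite setTI /preimage; under eq_set do rewrite /= in_itv/= andbT.
Qed.

Lemma measurable_ge_level d (T : measurableType d) (R : realType) (X : T -> R)
  (c : R) : measurable_fun setT X -> measurable [set w | c <= X w].
Proof.
move=> /(_ measurableT [set` `[c, +oo[] (measurable_itv _)).
by rewrite setTI /preimage; under eq_set do rewrite /= in_itv/= andbT.
Qed.

Lemma measurable_le_level d (T : measurableType d) (R : realType) (X : T -> R)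
  (c : R) : measurable_fun setT X -> measurable [set w | X w <= c].
Proof.
move=> /(_ measurableT [set` `]-oo, c]] (measurable_itv _)).
by rewrite setTI /preimage; under eq_set do rewrite /= in_itv/=.
Qed.

Section paths.
Context {d : measure_display} {T : measurableType d} {R : realType}.
Implicit Types (X : R -> T -> R) (S : T -> R).

(** The random time S is approached from the right by the random times
    (floor (n S) + 1) / n, each taking countably many values, so that
    right continuity of the paths applies. *)
Lemma measurable_time_change X S :
  (forall t, 0 <= t -> measurable_fun setT (X t)) ->
  (forall w t, 0 <= t -> X ^~ w @ t^'+ --> X t w) ->
  measurable_fun setT S -> (forall w, 0 <= S w) ->
  measurable_fun setT (fun w => X (S w) w).
Proof.
move=> mX rcX mS S0.
pose k n w := Num.truncn (S w * n.+1%:R).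
have kE n w : (k n w)%:R <= S w * n.+1%:R < (k n w).+1%:R.
  by apply: truncn_itv; rewrite mulr_ge0.
pose h n w := X ((k n w).+1%:R / n.+1%:R) w.
apply: (@measurable_fun_cvg _ _ _ _ h) => [n _ B mB|w _].
  rewrite [X in measurable X](_ : _ = \bigcup_j
      ([set w | j%:R <= S w * n.+1%:R < j.+1%:R] `&`
       (X (j.+1%:R / n.+1%:R) @^-1` B))); last first.
    apply/seteqP; split => [w [_ Bw]|w [j _ [/= Sj Bj]]].
      by exists (k n w) => //; split => //=; exact: kE.
    by split => //=; rewrite /h (_ : k n w = j)//; exact: truncn_def.
  apply: bigcup_measurable => j _; apply: measurableI.
    have mSn : measurable_fun setT (fun w => S w * n.+1%:R).
      exact: measurable_funM.
    have -> : [set w | j%:R <= S w * n.+1%:R < j.+1%:R] =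
       (fun w => S w * n.+1%:R) @^-1` [set` `[j%:R, j.+1%:R[].
      by apply/seteqP; split => w /=; rewrite in_itv/=.
    by rewrite -[X in measurable X]setTI; exact: mSn.
  have mXj : measurable_fun setT (X (j.+1%:R / n.+1%:R)) by exact: mX.
  by rewrite -[X in measurable X]setTI; exact: mXj.
have := rcX w _ (S0 w).
move=> /cvg_at_rightP; apply; split => [n|].
  have /andP[_] := kE n w.
  by rewrite ltr_pdivlMr.
apply/(@cvgrPdist_le _ R^o) => e e0.
near=> n.
have /andP[kn1 kn2] := kE n w.
have en : n.+1%:R^-1 <= e.
  by apply: ltW; near: n; exact: (near_infty_natSinv_lt (PosNum e0)).
have SL : (k n w)%:R / n.+1%:R <= S w by rewrite ler_pdivrMr.
have SU : S w < (k n w).+1%:R / n.+1%:R by rewrite ltr_pdivlMr.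
move: SU SL; rewrite -[(k n w).+1%:R]natr1 mulrDl mul1r.
have : 0 <= n.+1%:R^-1 :> R by rewrite invr_ge0.
move: en; move: (_ / _) => u; move: (_^-1) => v ve v0 Su uS.
by rewrite ler_norml; apply/andP; split; lra.
Unshelve. all: end_near. Qed.

(** A right-continuous path that decreases between two times also decreases
    between two rational times slightly to their right; so the exceptional set
    is a countable union of null events. *)
Lemma ae_nondecreasing (P : probability T R) X :
  (forall t, 0 <= t -> measurable_fun setT (X t)) ->
  (forall w t, 0 <= t -> X ^~ w @ t^'+ --> X t w) ->
  (forall s t, 0 <= s < t -> P [set w | X t w < X s w] = 0%E) ->
  exists Z, [/\ measurable Z, P Z = 0%E &
    forall w, ~ Z w -> forall s t, 0 <= s <= t -> X s w <= X t w].
Proof.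
move=> mX rcX X0.
pose A (u : rat * rat) :=
  if (0 <= ratr u.1 :> R) && (ratr u.1 < ratr u.2 :> R) then
    [set w | X (ratr u.2) w < X (ratr u.1) w] else set0.
have mA u : measurable (A u).
  rewrite /A; case: ifPn => // /andP[u0 u12].
  have u2_ge0 : 0 <= ratr u.2 :> R by exact: le_trans u0 (ltW u12).
  have mB : measurable_fun setT (fun w => X (ratr u.2) w - X (ratr u.1) w).
    by apply: measurable_funB; exact: mX.
  have := mB measurableT [set` `]-oo, 0[] (measurable_itv _).
  by rewrite setTI /preimage; under eq_set do rewrite /= in_itv/= subr_lt0.
have A0 u : P (A u) = 0%E.
  by rewrite /A; case: ifPn => // u0; exact: X0.
pose F n := if choice.unpickle n is Some u then A u else set0.
have mF n : measurable (F n) by rewrite /F; case: choice.unpickle.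
exists (\bigcup_n F n); split.
- by apply: bigcup_measurable.
- apply: measure_negligible; first exact: bigcup_measurable.
  apply: negligible_bigcup => n; exists (F n); split => //.
  by rewrite /F; case: choice.unpickle.
move=> w Zw s t /andP[s0]; rewrite le_eqVlt => /predU1P[->//|st].
rewrite leNgt; apply/negP => Xts.
pose m := (X s w + X t w) / 2.
have m1 : X t w < m by rewrite /m; lra.
have m2 : m < X s w by rewrite /m; lra.
have t0 : 0 <= t by lra.
have : \forall x \near t^'+, X x w < m.
  exact: (cvgr_lt (X t w) (rcX w t t0)).
have : \forall x \near s^'+, m < X x w.
  exact: (cvgr_gt (X s w) (rcX w s s0)).
rewrite !near_withinE.
move=> /nbhs_ballP[e1/= e10 H1] /nbhs_ballP[e2/= e20 H2].
have [q] : exists q, ratr q \in `]s, Num.min t (s + e1)[.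
  by apply: rat_in_itvoo; rewrite lt_min st ltrDl.
rewrite in_itv/= lt_min => /andP[sq /andP[qt qe]].
have [q'] : exists q, ratr q \in `]t, (t + e2)[.
  by apply: rat_in_itvoo; rewrite ltrDl.
rewrite in_itv/= => /andP[tq' q'e].
have Hq : m < X (ratr q) w.
  by apply: H1 => //=; rewrite /ball/= distrC gtr0_norm ?subr_gt0//; lra.
have Hq' : X (ratr q') w < m.
  by apply: H2 => //=; rewrite /ball/= distrC gtr0_norm ?subr_gt0//; lra.
have Aw : A (q, q') w.
  rewrite /A/= ifT; first exact: lt_trans Hq.
  by apply/andP; split; lra.
apply: Zw; exists (choice.pickle (q, q')); first exact: I.
by rewrite /F choice.pickleK; exact: Aw.
Qed.

End paths.

(** * The inverse of a nondecreasing path *)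

Section inverse.
Context {T : Type} {R : realType} (D : R -> T -> R) (w : T).
Local Notation E := (inverse_process D).
Local Notation passage t := [set s : R | 0 < s /\ t < D s w].

Lemma inverse_process_ge0 t : 0 <= E t w.
Proof.
rewrite /inverse_process; have [->|/set0P S0] := eqVneq (passage t) set0.
  by rewrite inf0.
by apply: lb_le_inf => // s [/ltW].
Qed.

Lemma inverse_process_le t s : 0 < s -> t < D s w -> E t w <= s.
Proof.
move=> s0 ts; apply: ge_inf; last by split.
by exists 0 => x [/ltW].
Qed.

Hypothesis D0 : D 0 w = 0.
Hypothesis D_nd : forall s t, 0 <= s <= t -> D s w <= D t w.

(** The level b guarantees that the infimum is over a nonempty set; the infimum
    of the empty set is 0, so the bound would fail on a bounded path. *)
Lemma le_inverse_process t a b : 0 <= a -> D a w <= t -> 0 < b -> t < D b w ->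
  a <= E t w.
Proof.
move=> a0 Dat b0 Dbt; apply: lb_le_inf; first by exists b.
move=> s [s0 ts]; rewrite leNgt; apply/negP => sa.
have : D s w <= D a w by apply: D_nd; rewrite !ltW.
lra.
Qed.

(** Expresses the events E(t) > r by countably many events on D at fixed times,
    which makes E(t) measurable. The second clause says that the path passes the
    level t. *)
Lemma lt_inverse_process t r : 0 <= t -> 0 <= r ->
  r < E t w <-> (exists q : rat, r < ratr q /\ D (ratr q) w <= t) /\
                (exists n : nat, t < D n%:R w).
Proof.
move=> t0 r0; split; last first.
  move=> [[q [rq qt]] [n tn]]; apply: (lt_le_trans rq).
  apply: (@le_inverse_process _ _ n%:R) => //; first by lra.
  rewrite lt_neqAle ler0n andbT; apply/eqP => n0.
  by move: tn; rewrite -n0 D0; lra.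
move=> rE; split.
  have [q] := rat_in_itvoo rE.
  rewrite in_itv/= => /andP[rq qE]; exists q; split => //.
  rewrite leNgt; apply/negP => tq.
  have : E t w <= ratr q by apply: inverse_process_le => //; lra.
  lra.
have [S0|] := eqVneq (passage t) set0.
  by move: rE; rewrite /inverse_process S0 inf0; lra.
move=> /set0P[s [s0 ts]]; exists (Num.truncn s).+1.
apply: (lt_le_trans ts); apply: D_nd.
by rewrite ltW//= ltW// truncnS_gt.
Qed.

(** Also true at levels t that the path never passes: from there on the infima
    are over empty sets and E is constant. *)
Lemma inverse_process_right_continuous t : E ^~ w @ t^'+ --> E t w.
Proof.
have [S0|] := eqVneq (passage t) set0.
  have EE u : t <= u -> E u w = 0.
    move=> tu; rewrite /inverse_process (_ : passage u = set0) ?inf0//.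
    rewrite -subset0 => s [s0 us]; rewrite -S0; split => //; lra.
  apply: (@cvg_trans _ ((fun=> 0 : R) @ t^'+)).
    apply: near_eq_cvg; near=> u; rewrite EE//; near: u; exact: nbhs_right_ge.
  by rewrite EE//; exact: cvg_cst.
move=> S0; apply/(@cvgrPdist_le _ R^o) => e e0.
have hi : has_inf (passage t).
  by split; [exact/set0P|exists 0 => x [/ltW]].
have [s [s0 ts]] := inf_adherent e0 hi.
rewrite -/(E t w) => sE.
near=> u.
have tu : t < u by near: u; exact: nbhs_right_gt.
have us : u < D s w by near: u; exact: nbhs_right_lt.
have Eus := inverse_process_le s0 us.
have Etu : E t w <= E u w.
  apply: lb_le_inf; first by exists s.
  by move=> x [x0 ux]; apply: inverse_process_le => //; lra.
rewrite distrC ger0_norm ?subr_ge0//; lra.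
Unshelve. all: end_near. Qed.

End inverse.

Lemma measurable_inverse_process d (T : measurableType d) (R : realType)
    (D : R -> T -> R) t : 0 <= t ->
  (forall s, 0 <= s -> measurable_fun setT (D s)) ->
  (forall w, D 0 w = 0) ->
  (forall w s u, 0 <= s <= u -> D s w <= D u w) ->
  measurable_fun setT (inverse_process D t).
Proof.
move=> t0 mD D0 Dnd.
apply: (measurability _ (RGenOInfty.measurableE R)) => //.
move=> /= _ [_ [r ->] <-]; rewrite setTI.
have [r0|r0] := ltP r 0.
  rewrite (_ : _ @^-1` _ = setT)//; apply/seteqP; split => // w _ /=.
  rewrite in_itv/= andbT; exact: (lt_le_trans r0 (inverse_process_ge0 _ _ _)).
pose F q := if r < ratr q then [set w | D (ratr q) w <= t] else set0.
rewrite (_ : _ @^-1` _ =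
    (\bigcup_q F q) `&` (\bigcup_n [set w | t < D n%:R w])).
  apply: measurableI.
    apply: bigcupT_measurable_rat => q; rewrite /F; case: ifPn => // rq.
    have q0 : 0 <= ratr q :> R by exact: (le_trans r0 (ltW rq)).
    exact: (measurable_le_level t (mD _ q0)).
  apply: bigcup_measurable => n _.
  exact: (measurable_gt_level t (mD _ (ler0n R n))).
apply/seteqP; split => w /=; rewrite in_itv/= andbT.
  move=> /(lt_inverse_process (D0 w) (Dnd w) t0 r0)[[q [rq qt]] [n tn]].
  by split; [exists q => //; rewrite /F rq|exists n].
move=> [[q _ +] [n _ tn]]; rewrite /F; case: ifPn => // rq qt.
apply/(lt_inverse_process (D0 w) (Dnd w) t0 r0); split.
  by exists q.
by exists n.
Qed.

(** * Chernoff bounds from a Laplace transform *)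

Section laplace_bounds.
Context {d : measure_display} {T : measurableType d} {R : realType}.
Context (P : probability T R) (X : T -> R) (u l : R).
Hypothesis mX : measurable_fun setT X.
Hypothesis X_ge0 : forall w, 0 <= X w.
Hypothesis u_gt0 : 0 < u.
Hypothesis laplace_l : ('E_P[fun w => expR (- (u^-1 * X w))] = l%:E)%E.

Let A := [set w | X w <= u].

Let mA : measurable A. Proof. exact: measurable_le_level. Qed.

Let mf D : measurable_fun D (fun w => (expR (- (u^-1 * X w)))%:E).
Proof.
apply: (@measurable_funS _ _ _ _ setT) => //.
apply/measurable_EFinP; apply: measurableT_comp => //.
by apply: measurableT_comp => //; exact: measurable_funM.
Qed.

(** exp (- X / u) is at least 1/e on the event X <= u. *)
Lemma laplace_le_level_le : (P [set w | (X w <= u)%R] <= (expR 1 * l)%R%:E)%E.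
Proof.
have H : ((expR (- 1))%R%:E * P A <= l%:E)%E.
  rewrite -laplace_l unlock -integral_cst//.
  apply: (@le_trans _ _ (\int[P]_(w in A) (expR (- (u^-1 * X w)))%R%:E)%E).
    apply: ge0_le_integral => //.
    - by move=> w _; rewrite lee_fin expR_ge0.
    - move=> w Aw; rewrite lee_fin ler_expR lerN2.
      by rewrite mulrC ler_pdivrMr// mul1r.
  exact: ge0_subset_integral.
have : (P A <= (expR 1)%:E * l%:E)%E.
  by rewrite -lee_pdivrMl ?expR_gt0// -expRN.
by rewrite -EFinM.
Qed.

(** exp (- X / u) is at most 1 on the event X <= u and at most 1/e off it. *)
Lemma laplace_le_level_ge :
  ((l - expR (- 1))%R%:E <= P [set w | (X w <= u)%R])%E.
Proof.
have H : (l%:E <= P A + (expR (- 1))%R%:E)%E.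
  rewrite -laplace_l unlock -(setUv A) ge0_integral_setU//; last 2 first.
  - exact: measurableC.
  - exact/disj_setPCl.
  apply: leeD.
    rewrite -[leRHS]mul1e -integral_cst//.
    apply: ge0_le_integral => //.
    move=> w _; rewrite lee_fin -expR0 ler_expR oppr_le0.
    by rewrite mulr_ge0// invr_ge0 ltW.
  apply: (@le_trans _ _ (\int[P]_(w in ~` A) (expR (- 1))%R%:E)%E).
    apply: ge0_le_integral => //.
    - exact: measurableC.
    - move=> w /= /negP; rewrite -ltNge => uX; rewrite lee_fin ler_expR lerN2.
      by rewrite mulrC ler_pdivlMr// mul1r ltW.
  rewrite integral_cst//; last exact: measurableC.
  rewrite -[leRHS]mule1 lee_pmul2l ?lte_fin ?expR_gt0//.
  exact/probability_le1/measurableC.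
by rewrite -/A EFinB leeBlDr.
Qed.

End laplace_bounds.

(** * The gamma density of small shape *)

Lemma integral_powR {R : realType} (x e : R) : 0 < x -> 0 < e < 1 ->
  (\int[lebesgue_measure]_(y in `[e, 1%R]) (y `^ (x - 1))%R%:E =
   ((1 - e `^ x) / x)%R%:E)%E.
Proof.
move=> x0 /andP[e0 e1].
have dF (y : R) : 0 < y ->
    is_derive y 1 (fun y => x^-1 * y `^ x) (y `^ (x - 1)).
  move=> y0; have := is_derive1_powR x y0 => dp.
  apply: is_derive_eq.
  by rewrite /GRing.scale/= mulrA mulVf ?gt_eqF// mul1r.
have cp (z y : R) : 0 < y -> {for y, continuous (fun y : R => y `^ z)}.
  move=> y0; apply: differentiable_continuous.
  apply/derivable1_diffP.
  exact: (@ex_derive _ _ _ _ _ _ _ (is_derive1_powR z y0)).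
have cF (y : R) : 0 < y -> {for y, continuous (fun y : R => x^-1 * y `^ x)}.
  by move=> y0; apply: cvgM; [exact: cvg_cst|exact: cp].
rewrite (@continuous_FTC2 _ _ (fun y => x^-1 * y `^ x)) //.
- by rewrite -EFinB powR1 -mulrBr mulrC.
- apply: continuous_in_subspaceT => y; rewrite inE/= in_itv/= => /andP[ey _].
  by apply: cp; lra.
- split.
  + by move=> y; rewrite in_itv/= => /andP[ey _]; have /dF[] : 0 < y by lra.
  + by apply: cvg_at_right_filter; apply: cF.
  + by apply: cvg_at_left_filter; apply: cF.
- move=> y; rewrite in_itv/= => /andP[ey _].
  by rewrite derive1E; have /dF/@derive_val : 0 < y by lra.
Qed.

Section gamma_bounds.
Context {R : realType} (a x : R).
Hypotheses (a_gt0 : 0 < a) (x_gt0 : 0 < x).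
Local Notation mu := (@lebesgue_measure R).
Implicit Types (y e : R).

Definition gamma_norm : R := a `^ x / gamma_fun x.

Lemma gamma_norm_ge0 : 0 <= gamma_norm.
Proof.
rewrite divr_ge0 ?powR_ge0//; apply: Rintegral_ge0 => y _.
by rewrite mulr_ge0 ?powR_ge0 ?expR_ge0.
Qed.

Lemma gamma_pdf_ge0 y : 0 <= gamma_pdf a x y.
Proof.
by rewrite mulr_ge0 ?expR_ge0// mulr_ge0 ?powR_ge0 ?gamma_norm_ge0.
Qed.

Lemma measurable_gamma_pdf D :
  measurable_fun D (fun y => (gamma_pdf a x y)%:E).
Proof.
apply: measurable_funTS; apply/measurable_EFinP.
rewrite /gamma_pdf; apply: measurable_funM.
  by apply: measurable_funM => //; exact: measurable_powR.
by apply: measurableT_comp => //; apply: measurableT_comp => //;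
  exact: measurable_funM.
Qed.

Lemma gamma_prob_sub_pos B : B `<=` `]0, +oo[ ->
  gamma_prob a x B = (\int[mu]_(y in B) (gamma_pdf a x y)%:E)%E.
Proof. by move=> B0; rewrite /gamma_prob (setIidl B0). Qed.

(** The exponential factor is at least exp (- a) up to 1. *)
Lemma gamma_prob_near0_ge e : 0 < e < 1 ->
  ((gamma_norm * expR (- a) * ((1 - e `^ x) / x))%R%:E <=
   gamma_prob a x `[e, 1%R])%E.
Proof.
move=> /andP[e0 e1].
rewrite gamma_prob_sub_pos; last first.
  by move=> y /=; rewrite !in_itv/= andbT => /andP[ey _]; lra.
rewrite EFinM -integral_powR ?e0// -ge0_integralZl_EFin//; last 3 first.
- by move=> y _; rewrite lee_fin powR_ge0.
- by apply/measurable_EFinP; apply: measurable_funTS.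
- by rewrite mulr_ge0 ?expR_ge0 ?gamma_norm_ge0.
apply: ge0_le_integral => //.
- move=> y _; rewrite -EFinM lee_fin mulr_ge0 ?powR_ge0//.
  by rewrite mulr_ge0 ?expR_ge0 ?gamma_norm_ge0.
- apply/measurable_EFinP; apply: measurable_funTS.
  by apply: measurable_funM => //; exact: measurable_powR.
- exact: measurable_gamma_pdf.
move=> y /=; rewrite in_itv/= => /andP[ey y1].
rewrite lee_fin /gamma_pdf -/gamma_norm mulrAC ler_wpM2l//.
  by rewrite mulr_ge0 ?gamma_norm_ge0 ?powR_ge0.
by rewrite ler_expR lerN2 ger_pMr.
Qed.

(** Already the interval [1, 2] carries this mass: there
    y^(x - 1) >= 1/y >= 1/2. *)
Lemma gamma_prob_ge1_ge : x <= 1 ->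
  ((gamma_norm * (expR (- (2 * a)) / 2))%R%:E <=
   gamma_prob a x `[1%R, +oo[)%E.
Proof.
move=> x1.
rewrite gamma_prob_sub_pos; last first.
  by move=> y /=; rewrite !in_itv/= !andbT => ?; lra.
apply: (@le_trans _ _ (\int[mu]_(y in `[1%R, 2%R]) (gamma_pdf a x y)%:E)%E).
  rewrite [leLHS](_ : _ = \int[mu]_(y in `[1%R, 2%R])
     (gamma_norm * (expR (- (2 * a)) / 2))%R%:E)%E; last first.
    rewrite integral_cst//= lebesgue_measure_itv/= lte_fin ltr1n -EFinB -EFinM.
    by congr EFin; lra.
  apply: ge0_le_integral => //.
  - by move=> y _; rewrite lee_fin mulr_ge0 ?gamma_norm_ge0.
  - exact: measurable_gamma_pdf.
  move=> y /=; rewrite in_itv/= => /andP[y1 y2].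
  rewrite lee_fin /gamma_pdf -/gamma_norm -mulrA ler_wpM2l ?gamma_norm_ge0//.
  rewrite mulrC ler_pM ?expR_ge0//.
    apply: (@le_trans _ _ (y `^ (- 1))).
      have y0 : 0 < y by lra.
      by rewrite powR_inv1 ?(ltW y0)// lef_pV2 ?posrE.
    by apply: ler_powR => //; rewrite lerBrDr addNr ltW.
  by rewrite ler_expR lerN2 mulrC ler_pM2r.
apply: ge0_subset_integral => //.
- exact: measurable_gamma_pdf.
- by move=> y _; rewrite lee_fin gamma_pdf_ge0.
- by move=> y /=; rewrite !in_itv/= andbT => /andP[].
Qed.

(** The factor exp (- a y) is bounded by 1 on [e, 1], and y^(x - 1) by 1 beyond,
    where an exponential density of mass 1 remains. *)
Lemma gamma_prob_tail_le e : x <= 1 -> 0 < e < 1 ->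
  (gamma_prob a x `]e, +oo[ <=
   (gamma_norm * ((1 - e `^ x) / x + a^-1))%R%:E)%E.
Proof.
move=> x1 /andP[e0 e1].
rewrite gamma_prob_sub_pos; last first.
  by move=> y /=; rewrite !in_itv/= !andbT => ?; lra.
apply: (@le_trans _ _
    (\int[mu]_(y in `[e, 1%R] `|` `]1%R, +oo[) (gamma_pdf a x y)%:E)%E).
  apply: ge0_subset_integral => //.
  - exact: measurableU.
  - exact: measurable_gamma_pdf.
  - by move=> y _; rewrite lee_fin gamma_pdf_ge0.
  - move=> y /=; rewrite !in_itv/= !andbT => ey.
    by case: (leP y 1) => y1; [left; rewrite ltW|right].
rewrite ge0_integral_setU//; last 3 first.
- exact: measurable_gamma_pdf.
- by move=> y _; rewrite lee_fin gamma_pdf_ge0.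
- apply/disj_setPS => y [] /=; rewrite !in_itv/= andbT => /andP[_ ?] ?; lra.
rewrite mulrDr EFinD; apply: leeD.
  rewrite EFinM -integral_powR ?e0// -ge0_integralZl_EFin//; last 3 first.
  - by move=> y _; rewrite lee_fin powR_ge0.
  - by apply/measurable_EFinP; apply: measurable_funTS.
  - exact: gamma_norm_ge0.
  apply: ge0_le_integral => //.
  - by move=> y _; rewrite lee_fin gamma_pdf_ge0.
  - exact: measurable_gamma_pdf.
  - apply/measurable_EFinP; apply: measurable_funTS.
    by apply: measurable_funM => //; exact: measurable_powR.
  move=> y /=; rewrite in_itv/= => /andP[ey y1].
  rewrite lee_fin /gamma_pdf -/gamma_norm ler_piMr//.
    by rewrite mulr_ge0 ?gamma_norm_ge0 ?powR_ge0.
  rewrite -expR0 ler_expR oppr_le0 mulr_ge0 ?(ltW a_gt0)//.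
  by rewrite (le_trans (ltW e0) ey).
have mexp D : measurable_fun D (fun y => (exponential_pdf a y)%:E).
  apply: measurable_funTS.
  apply/measurable_EFinP; exact: measurable_exponential_pdf.
have exp0 z : (0 <= (exponential_pdf a z)%:E)%E.
  by rewrite lee_fin exponential_pdf_ge0 ?ltW.
have c0 : 0 <= gamma_norm / a by rewrite divr_ge0 ?gamma_norm_ge0 ?ltW.
apply: (@le_trans _ _ (\int[mu]_(y in `]1%R, +oo[)
   ((gamma_norm / a)%R%:E * (exponential_pdf a y)%:E))%E).
  apply: ge0_le_integral => //.
  - by move=> y _; rewrite lee_fin gamma_pdf_ge0.
  - exact: measurable_gamma_pdf.
  - apply: (@eq_measurable_fun _ _ _ _ _
        (EFin \o (fun y => (gamma_norm / a) * exponential_pdf a y))).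
      by move=> y _ /=; rewrite EFinM.
    apply/measurable_EFinP; apply: measurable_funM => //.
    exact/measurable_EFinP.
  move=> y /=; rewrite in_itv/= andbT => y1.
  rewrite -EFinM lee_fin exponential_pdfE; last by lra.
  rewrite mulrA divfK ?gt_eqF// /gamma_pdf -/gamma_norm -mulrA mulNr.
  rewrite ler_wpM2l ?gamma_norm_ge0// ler_piMl ?expR_ge0//.
  by rewrite -[leRHS](powRr0 y); apply: ler_powR; [exact: ltW|rewrite subr_le0].
rewrite ge0_integralZl_EFin//; last exact: mexp.
rewrite -[leRHS]mule1; apply: lee_wpmul2l => //.
rewrite -(integral_exponential_pdf a_gt0).
by apply: ge0_subset_integral => //; exact: mexp.
Qed.

End gamma_bounds.

(** * The gamma process at small times *)

Section gamma_process.
Context {d : measure_display} {T : measurableType d} {R : realType}.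
Context (P : probability T R) (alpha p : R) (G : R -> T -> R).
Hypotheses (alpha_gt0 : 0 < alpha) (p_gt0 : 0 < p).
Hypothesis G_gamma : gamma_subordinator P alpha p G.
Context (t : R).
Hypotheses (t_gt0 : 0 < t) (pt_le1 : p * t <= 1).

Local Notation K := (gamma_norm alpha (p * t)).
Let pt_gt0 : 0 < p * t. Proof. by rewrite mulr_gt0. Qed.

Lemma gamma_process_measurable s : 0 <= s -> measurable_fun setT (G s).
Proof.
move=> s0; have [[+ _] _] := G_gamma.
by move=> /levy_measurable; exact.
Qed.

Let mG : measurable_fun setT (G t).
Proof. by apply: gamma_process_measurable; exact: ltW. Qed.

Let law B : measurable B -> P (G t @^-1` B) = gamma_prob alpha (p * t) B.
Proof. by move=> mB; exact: (gamma_marginal G_gamma t_gt0 mB). Qed.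

(** The interval [e, 1] has probability at most 1, and for the e chosen in the
    proof its mass under y^(x - 1), with x = p t, is half of the total mass 1/x
    on [0, 1]. *)
Lemma gamma_norm_le : K <= 2 * (p * t) * expR alpha.
Proof.
pose e : R := 2^-1 `^ (p * t)^-1.
have e0 : 0 < e by rewrite powR_gt0.
have e1 : e < 1.
  have : 2^-1 `^ (p * t)^-1 < 1 `^ (p * t)^-1 :> R.
    by apply: gt0_ltr_powR; rewrite ?invr_gt0 ?nnegrE//; lra.
  by rewrite powR1.
have ex : e `^ (p * t) = 2^-1.
  by rewrite /e -powRrM mulVf ?gt_eqF// powRr1.
have e01 : 0 < e < 1 by rewrite e0.
have := gamma_prob_near0_ge alpha_gt0 pt_gt0 e01.
rewrite -law// ex => H.
have : (P (G t @^-1` `[e, 1%R]) <= 1)%E.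
  by apply: probability_le1; rewrite -[X in measurable X]setTI; exact: mG.
move=> /(le_trans H); rewrite lee_fin expRN.
rewrite (_ : 1 - 2^-1 = 2^-1); last by lra.
have ea : 0 < expR alpha by exact: expR_gt0.
have -> : K / expR alpha * (2^-1 / (p * t)) = K / (2 * (p * t) * expR alpha).
  by field; rewrite ?gt_eqF.
by rewrite ler_pdivrMr ?mul1r// !mulr_gt0.
Qed.

(** Up to the factor 2 exp alpha this is t times a bound for the mass that the
    Levy measure p exp (- alpha y) / y dy gives to jumps larger than e: the
    interval [e, 1] contributes - ln e, and the jumps beyond 1 contribute
    1 / alpha. *)
Lemma gamma_process_gt_le e : 0 < e < 1 ->
  (P [set w | (e < G t w)%R] <=
   (2 * (p * t) * expR alpha * (alpha^-1 - ln e))%R%:E)%E.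
Proof.
move=> /andP[e0 e1].
have := gamma_prob_tail_le alpha_gt0 pt_gt0 pt_le1 (introT andP (conj e0 e1)).
rewrite -law// (_ : _ @^-1` _ = [set w | e < G t w]); last first.
  by apply/seteqP; split => w /=; rewrite in_itv/= andbT.
move=> /le_trans; apply; rewrite lee_fin.
have lne : ln e < 0 by rewrite ln_lt0// e0.
have le_ln : (1 - e `^ (p * t)) / (p * t) <= - ln e.
  rewrite ler_pdivrMr// /powR gt_eqF//.
  have := expR_ge1Dx (p * t * ln e); lra.
apply: (@le_trans _ _ (K * (alpha^-1 - ln e))).
  by rewrite ler_wpM2l ?gamma_norm_ge0// addrC lerD2l.
rewrite ler_wpM2r ?gamma_norm_le// subr_ge0 (le_trans (ltW lne))//.
by rewrite invr_ge0 ltW.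
Qed.

(** The tail bounds of G(t) > 1 / (n + 2) stay below one constant, and these
    probabilities increase to P(G(t) > 0) = 1. *)
Lemma gamma_norm_ge : p * t * (alpha / (alpha + 1)) <= K.
Proof.
pose F n := [set w | n.+2%:R^-1 < G t w].
have mF n : measurable (F n) by exact: measurable_gt_level.
have FK n : (P (F n) <= (K * ((p * t)^-1 + alpha^-1))%R%:E)%E.
  have n1 : 0 < (n.+2%:R^-1 : R) < 1.
    by rewrite invr_gt0 ltr0n/= invf_lt1// ltr1n.
  have := gamma_prob_tail_le alpha_gt0 pt_gt0 pt_le1 n1.
  rewrite -law// (_ : _ @^-1` _ = F n); last first.
    by apply/seteqP; split => w /=; rewrite in_itv/= andbT.
  move=> /le_trans; apply; rewrite lee_fin ler_wpM2l ?gamma_norm_ge0//.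
  by rewrite lerD2r ler_piMl ?invr_ge0 ?(ltW pt_gt0)// lerBlDr lerDl powR_ge0.
have PF1 : P (\bigcup_n F n) = 1%E.
  transitivity (P (G t @^-1` `]0, +oo[)).
    congr (P _); apply/seteqP; split => w /=; rewrite in_itv/= andbT.
      by move=> [n _ /=]; apply: lt_trans; rewrite invr_gt0.
    move=> G0; exists (Num.truncn (G t w)^-1) => //.
    rewrite /F/= invf_plt ?posrE//.
    by rewrite (lt_trans (truncnS_gt _))// ltr_nat.
  rewrite law// gamma_prob_sub_pos//.
  have := law measurableT; rewrite /gamma_prob setTI => <-.
  by rewrite preimage_setT probability_setT.
have cvF : P \o F @ \oo --> P (\bigcup_n F n).
  apply: nondecreasing_cvg_mu => //.
    exact: bigcupT_measurable.
  move=> m n mn; apply/subsetPset => w /=; apply: le_lt_trans.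
  by rewrite lef_pV2 ?posrE// ler_nat.
have : (1 <= (K * ((p * t)^-1 + alpha^-1))%R%:E)%E.
  rewrite -PF1 -(cvg_lim _ cvF)//; apply: lime_le.
    by apply/cvg_ex; exists (P (\bigcup_n F n)).
  by apply: nearW => n; exact: FK.
rewrite lee_fin => H.
have le1 : (p * t)^-1 + alpha^-1 <= (alpha + 1) / alpha / (p * t).
  rewrite mulrDl mulfV ?gt_eqF// mul1r mulrDl mul1r lerD2l.
  by rewrite ler_peMr ?invr_ge0 ?(ltW alpha_gt0)// invf_ge1.
have a1 : 0 < alpha + 1 by rewrite addr_gt0.
have H1 : 1 <= K * ((alpha + 1) / alpha / (p * t)).
  by apply: (le_trans H); rewrite ler_wpM2l ?gamma_norm_ge0.
have -> : p * t * (alpha / (alpha + 1)) =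
    ((alpha + 1) / alpha / (p * t))^-1.
  by field; rewrite ?gt_eqF.
by rewrite -[leLHS]mul1r ler_pdivrMr// !divr_gt0.
Qed.

(** On [1, 2] the density is of the order of its normalising constant, which is
    of order p t. *)
Lemma gamma_process_ge1_ge :
  ((p * t * (alpha / (alpha + 1) * (expR (- (2 * alpha)) / 2)))%R%:E <=
   P [set w | (1 <= G t w)%R])%E.
Proof.
have := gamma_prob_ge1_ge alpha_gt0 pt_gt0 pt_le1.
rewrite -law// (_ : _ @^-1` _ = [set w | 1 <= G t w]); last first.
  by apply/seteqP; split => w /=; rewrite in_itv/= andbT.
by apply: le_trans; rewrite lee_fin mulrA ler_wpM2r ?gamma_norm_ge//.
Qed.

End gamma_process.

(** * The Poisson process *)

Section poisson.
Context {d : measure_display} {T : measurableType d} {R : realType}.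
Context (P : probability T R) (lambda : R) (N : R -> T -> nat).
Hypothesis lambda_gt0 : 0 < lambda.
Hypothesis N_poisson : poisson_process P lambda N.

Lemma poisson_process_measurable s : 0 <= s ->
  measurable_fun setT (fun w => (N s w)%:R : R).
Proof.
by move=> s0; have [+ _] := N_poisson; move=> /levy_measurable; exact.
Qed.

Lemma measurable_jumped s : 0 <= s -> measurable [set w | (0 < N s w)%N].
Proof.
move=> s0.
rewrite (_ : [set w | _] = [set w | (0 : R) < (N s w)%:R]).
  exact/measurable_gt_level/poisson_process_measurable.
by apply/seteqP; split => w /=; rewrite ltr0n.
Qed.

Lemma poisson_process_jumped s : 0 < s ->
  P [set w | (0 < N s w)%N] = (1 - expR (- (lambda * s)))%:E.
Proof.
move=> s0; rewrite -[LHS]fineK; last first.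
  by apply: fin_num_measure; apply: measurable_jumped; exact: ltW.
rewrite (_ : [set w | _] = ~` (N s @^-1` [set 0%N])); last first.
  by apply/seteqP; split => w /=; rewrite lt0n => /eqP.
rewrite probability_setC; last first.
  rewrite -[X in measurable X]setCK; apply: measurableC.
  rewrite (_ : ~` _ = [set w | (0 < N s w)%N]).
    by apply: measurable_jumped; exact: ltW.
  by apply/seteqP; split => w /=; rewrite lt0n => /eqP.
have := poisson_marginal N_poisson s0 [set 0%N].
rewrite /pushforward => ->.
rewrite /poisson_prob mulr_gt0// esum_set1; last first.
  by rewrite lee_fin poisson_pmf_ge0.
by rewrite /poisson_pmf mulr_gt0// expr0 fact0 invr1 !mul1r.
Qed.

(** The increments have the law of a value of N, hence are nonnegative almost
    surely. *)
Lemma poisson_process_nondecreasing : exists Z, [/\ measurable Z, P Z = 0%E &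
  forall w, ~ Z w -> forall s t, 0 <= s <= t -> (N s w <= N t w)%N].
Proof.
have levyN := poisson_levy N_poisson.
have [| | |Z [mZ PZ HZ]] := @ae_nondecreasing _ _ _ P (fun t w => (N t w)%:R).
- exact: (levy_measurable levyN).
- exact: (levy_right_continuous levyN).
- move=> s t /andP[s0 st].
  have st' : 0 <= s <= t by rewrite s0 ltW.
  have := levy_stationary_increments levyN st' (measurable_itv `]-oo, 0[).
  rewrite /pushforward (_ : _ @^-1` _ = [set w | (N t w)%:R < (N s w)%:R :> R]).
    move=> ->; rewrite (_ : _ @^-1` _ = set0) ?measure0//.
    by rewrite -subset0 => w /=; rewrite in_itv/= ltrn0.
  by apply/seteqP; split => w /=; rewrite in_itv/= subr_lt0.
exists Z; split => // w /HZ{}HZ s t st.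
by have := HZ _ _ st; rewrite ler_nat.
Qed.

End poisson.

(** * The stable subordinator *)

Section stable.
Context {d : measure_display} {T : measurableType d} {R : realType}.
Context (P : probability T R) (beta : R) (D : R -> T -> R).
Hypothesis D_stable : stable_subordinator P beta D.
Context (r u : R).
Hypotheses (r_ge0 : 0 <= r) (u_gt0 : 0 < u).

Let mD : measurable_fun setT (D r).
Proof.
have [[+ _] _] := D_stable.
by move=> /levy_measurable; exact.
Qed.

Let D_ge0 w : 0 <= D r w.
Proof.
have [[+ Dnd] _] := D_stable.
by move=> /levy_start/(_ w) <-; apply: Dnd; rewrite lexx.
Qed.

Let laplace : ('E_P[fun w => expR (- (u^-1 * D r w))] =
  (expR (- (r * u^-1 `^ beta)))%R%:E)%E.
Proof. by apply: (stable_laplace D_stable) => //; rewrite invr_ge0 ltW. Qed.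

Lemma stable_le_level_le :
  (P [set w | (D r w <= u)%R] <= (expR (1 - r * u^-1 `^ beta))%R%:E)%E.
Proof. by rewrite expRD; exact: laplace_le_level_le laplace. Qed.

Lemma stable_le_level_ge :
  ((expR (- (r * u^-1 `^ beta)) - expR (- 1))%R%:E <=
   P [set w | (D r w <= u)%R])%E.
Proof. exact: laplace_le_level_ge laplace. Qed.

End stable.

(** * Bounds for the two time-changed processes *)

Lemma process_sigma_preimage d d' (T : measurableType d) (V : measurableType d')
    (R : realType) (X : R -> T -> V) t B :
  0 <= t -> measurable B -> process_sigma X (X t @^-1` B).
Proof.
move=> t0 mB; apply: sub_gen_smallest; exists t => //.
by exists B => //; rewrite setTI.
Qed.

Lemma independent_three d (T : measurableType d) (R : realType)
    (P : probability T R) (F0 F1 F2 : set (set T)) (A0 A1 A2 : set T) :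
  independent_systems P (tnth [tuple F0; F1; F2]) ->
  F0 A0 -> F1 A1 -> F2 A2 ->
  P (A0 `&` A1 `&` A2) = (P A0 * P A1 * P A2)%E.
Proof.
move=> indF FA0 FA1 FA2.
pose J := [fset i in enum 'I_3]%fset.
have JE i : i \in J by rewrite in_fset mem_enum.
have := indF J (tnth [tuple A0; A1; A2]).
rewrite (perm_big (enum 'I_3)); last first.
  apply: uniq_perm; rewrite ?fset_uniq ?enum_uniq// => i.
  by rewrite JE mem_enum.
rewrite big_enum/= !big_ord_recl big_ord0 mule1 muleA => <-.
  congr (P _); apply/seteqP; split => w /=.
    move=> [[w0 w1] w2] [[|[|[|//]]] i3] _ //=;
    by rewrite (tnth_nth set0).
  move=> H; split; [split|].
  - exact: (H ord0 (JE _)).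
  - exact: (H (lift ord0 ord0) (JE _)).
  - exact: (H (lift ord0 (lift ord0 ord0)) (JE _)).
by move=> [[|[|[|//]]] i3] _; rewrite !(tnth_nth set0).
Qed.

Section time_changes.
Context {R : realType} {d : measure_display} {T : measurableType d}.
Context (P : probability T R) (alpha p lambda beta : R).
Context (N : R -> T -> nat) (G D : R -> T -> R).
Hypotheses (alpha_gt0 : 0 < alpha) (p_gt0 : 0 < p) (lambda_gt0 : 0 < lambda).
Hypothesis N_poisson : poisson_process P lambda N.
Hypothesis G_gamma : gamma_subordinator P alpha p G.
Hypothesis D_stable : stable_subordinator P beta D.
Local Notation E := (inverse_process D).

Let G_levy := subordinator_levy (gamma_is_subordinator G_gamma).
Let D_levy := subordinator_levy (stable_is_subordinator D_stable).
Let N_levy := poisson_levy N_poisson.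
Let G_nd := subordinator_nondecreasing (gamma_is_subordinator G_gamma).
Let D_nd := subordinator_nondecreasing (stable_is_subordinator D_stable).

Let G_ge0 t w : 0 <= t -> 0 <= G t w.
Proof. by move=> t0; rewrite -(levy_start G_levy w) G_nd// lexx. Qed.

Let mE t : 0 <= t -> measurable_fun setT (E t).
Proof.
move=> t0; apply: measurable_inverse_process => //.
- exact: levy_measurable D_levy.
- exact: levy_start D_levy.
Qed.

Let mN_time_change (S : T -> R) :
  measurable_fun setT S -> (forall w, 0 <= S w) ->
  measurable [set w | (0 < N (S w) w)%N].
Proof.
move=> mS S0; rewrite (_ : [set w | _] = [set w | (0 : R) < (N (S w) w)%:R]).
  apply: measurable_gt_level.
  apply: (@measurable_time_change _ _ _ (fun t w => (N t w)%:R)) => //.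
  - exact: levy_measurable N_levy.
  - exact: levy_right_continuous N_levy.
by apply/seteqP; split => w /=; rewrite ltr0n.
Qed.

Lemma measurable_N_G_E t : 0 <= t ->
  measurable [set w | (0 < time_change N (time_change G E) t w)%N].
Proof.
move=> t0; apply: mN_time_change.
  apply: measurable_time_change.
  - exact: levy_measurable G_levy.
  - exact: levy_right_continuous G_levy.
  - exact: mE.
  - by move=> w; exact: inverse_process_ge0.
by move=> w; apply: G_ge0; exact: inverse_process_ge0.
Qed.

Lemma measurable_N_E_G t : 0 <= t ->
  measurable [set w | (0 < fractional_negative_binomial N G D t w)%N].
Proof.
move=> t0; apply: mN_time_change.
  apply: measurable_time_change.
  - exact: mE.
  - move=> w s s0; exact: inverse_process_right_continuous.
  - exact: (levy_measurable G_levy).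
  - by move=> w; exact: G_ge0.
by move=> w; exact: inverse_process_ge0.
Qed.

(** The event D(a) <= t < D(b) forces E(t) >= a. In the scale t^beta of the
    stable process the Chernoff bounds are numbers: with a = t^beta / 4
    and b = 9 t^beta they give at least exp (- 1/4) - exp (- 1) - exp (- 8). *)
Lemma inverse_stable_ge t : 0 < t ->
  ((8^-1)%:E <= P [set w | (t `^ beta / 4 <= E t w)%R])%E.
Proof.
move=> t0; set a := t `^ beta / 4; pose b := 9 * t `^ beta.
have tb : 0 < t `^ beta by rewrite powR_gt0.
have a0 : 0 <= a by rewrite divr_ge0// ltW.
have b0 : 0 < b by rewrite mulr_gt0.
have tV : t^-1 `^ beta = (t `^ beta)^-1.
  by rewrite -(powR_inv1 (ltW t0)) -powRrM mulN1r powRN.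
have := stable_le_level_ge D_stable a0 t0.
have := stable_le_level_le D_stable (ltW b0) t0.
rewrite tV (_ : a * _ = 4^-1); last by rewrite /a; field; rewrite gt_eqF.
rewrite (_ : b * _ = 9); last by rewrite /b; field; rewrite gt_eqF.
set A := [set w | D a w <= t]; set B := [set w | D b w <= t] => PB PA.
set C := [set w | a <= E t w].
have mA : measurable A.
  by apply: measurable_le_level; exact: levy_measurable D_levy _ a0.
have mB : measurable B.
  by apply: measurable_le_level; exact: levy_measurable D_levy _ (ltW b0).
have mC : measurable C by apply: measurable_ge_level; apply: mE; exact: ltW.
have ABC : A `<=` C `|` B.
  move=> w Aw; case: (leP (D b w) t) => Db; [by right|left].
  apply: (le_inverse_process _ a0 Aw b0 Db).
  by move=> s u; exact: D_nd.
have PABC : (P A <= P C + P B)%E.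
  apply: (@le_trans _ _ (P (C `|` B))); last exact: measureU2.
  by apply: le_measure; rewrite ?inE//; exact: measurableU.
have PC : P C \is a fin_num by exact: fin_num_measure.
rewrite -(fineK PC) lee_fin.
have : ((expR (- 4^-1) - expR (- 1))%R%:E <=
        (fine (P C))%:E + (expR (1 - 9))%R%:E)%E.
  apply: (le_trans PA); apply: (le_trans PABC).
  by rewrite fineK// leeD2l.
rewrite -EFinD lee_fin.
have e4 := expR_ge1Dx (- 4^-1 : R).
have e1 : expR (- 1) <= 2^-1 :> R.
  rewrite expRN lef_pV2 ?posrE ?expR_gt0//.
  by have := expR_ge1Dx (1 : R).
have e9 : expR (1 - 9) <= 9^-1 :> R.
  rewrite (_ : 1 - 9 = - 8)//; last by lra.
  rewrite expRN lef_pV2 ?posrE ?expR_gt0//.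
  by have := expR_ge1Dx (8 : R); lra.
lra.
Qed.

Section lower.
Hypothesis NGE_independent : independent_systems P
  (tnth [tuple process_sigma N; process_sigma G; process_sigma E]).

(** If E(t) >= a, Gamma(a) >= 1 and N(1) > 0, then N(Gamma(E(t))) > 0 by
    monotonicity; the three events are independent. *)
Lemma P_N_G_E_ge t : 0 < t -> p * (t `^ beta / 4) <= 1 ->
  (((1 - expR (- lambda)) *
    (p * (t `^ beta / 4) *
      (alpha / (alpha + 1) * (expR (- (2 * alpha)) / 2))) * 8^-1)%R%:E <=
   P [set w | (0 < time_change N (time_change G E) t w)%N])%E.
Proof.
move=> t0; set a := t `^ beta / 4 => pa1.
have a0 : 0 < a by rewrite divr_gt0// powR_gt0.
have [Z [mZ PZ N_nd]] := poisson_process_nondecreasing N_poisson.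
set A0 := [set w | (0 < N 1 w)%N].
set A1 := [set w | 1 <= G a w].
set A2 := [set w | a <= E t w].
have mA0 : measurable A0 by exact: measurable_jumped N_poisson _ _.
have mA1 : measurable A1.
  by apply: measurable_ge_level; exact: levy_measurable G_levy _ (ltW a0).
have mA2 : measurable A2.
  by apply: measurable_ge_level; apply: mE; exact: ltW.
have sub : A0 `&` A1 `&` A2 `<=`
    [set w | (0 < time_change N (time_change G E) t w)%N] `|` Z.
  move=> w [[A0w A1w] A2w].
  have [Zw|Zw] := pselect (Z w); [by right|left].
  apply: (leq_trans A0w); apply: N_nd => //; rewrite ler01/=.
  by apply: (le_trans A1w); apply: G_nd; rewrite (ltW a0).
have mNGE := measurable_N_G_E (ltW t0).
apply: (@le_trans _ _ (P (A0 `&` A1 `&` A2))); last first.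
  rewrite -(measureU0 mNGE mZ PZ); apply: le_measure; rewrite ?inE//.
    by apply: measurableI => //; exact: measurableI.
  exact: measurableU.
rewrite (independent_three NGE_independent); first last.
- rewrite (_ : A2 = E t @^-1` `[a, +oo[).
    by apply: process_sigma_preimage => //; exact: ltW.
  by apply/seteqP; split => w /=; rewrite in_itv/= andbT.
- rewrite (_ : A1 = G a @^-1` `[1, +oo[).
    by apply: process_sigma_preimage => //; exact: ltW.
  by apply/seteqP; split => w /=; rewrite in_itv/= andbT.
- rewrite (_ : A0 = N 1 @^-1` [set n | (0 < n)%N])//.
  exact: process_sigma_preimage.
have PA0 : P A0 = (1 - expR (- lambda))%:E.
  by rewrite (poisson_process_jumped lambda_gt0 N_poisson)// mulr1.
have PA1 := gamma_process_ge1_ge alpha_gt0 p_gt0 G_gamma a0 pa1.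
have PA2 := inverse_stable_ge t0.
rewrite PA0 [leLHS]EFinM.
have e0 : 0 <= 1 - expR (- lambda).
  by rewrite subr_ge0 -expR0 ler_expR oppr_le0 ltW.
apply: lee_pmul => //.
- rewrite lee_fin mulr_ge0// mulr_ge0//; first by rewrite mulr_ge0 ?ltW.
  by rewrite mulr_ge0 ?divr_ge0 ?expR_ge0 ?addr_ge0 ?ltW.
- by rewrite [leLHS]EFinM lee_wpmul2l.
Qed.

End lower.

(** If Gamma(t) <= u < D(r), then E(Gamma(t)) <= r, so that a positive
    N(E(Gamma(t))) requires N(r) > 0; a union bound over the three failures. *)
Lemma P_N_E_G_le t u r : 0 < t -> p * t <= 1 -> 0 < u < 1 -> 0 < r ->
  (P [set w | (0 < fractional_negative_binomial N G D t w)%N] <=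
   (2 * (p * t) * expR alpha * (alpha^-1 - ln u) +
    expR (1 - r * u^-1 `^ beta) + lambda * r)%R%:E)%E.
Proof.
move=> t0 pt1 u01 r0; have /andP[u0 u1] := u01.
have [Z [mZ PZ N_nd]] := poisson_process_nondecreasing N_poisson.
set A := [set w | _].
pose A0 := [set w | (0 < N r w)%N].
pose A1 := [set w | u < G t w].
pose A2 := [set w | D r w <= u].
have mA : measurable A by exact: measurable_N_E_G (ltW t0).
have mA0 : measurable A0 by exact: measurable_jumped N_poisson _ (ltW r0).
have mA1 : measurable A1.
  by apply: measurable_gt_level; exact: levy_measurable G_levy _ (ltW t0).
have mA2 : measurable A2.
  by apply: measurable_le_level; exact: levy_measurable D_levy _ (ltW r0).
have sub : A `<=` (A1 `|` A2) `|` A0 `|` Z.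
  move=> w Aw.
  have [Zw|Zw] := pselect (Z w); [by right|left].
  have [uG|Gu] := ltP u (G t w); first by left; left.
  have [Du|uD] := leP (D r w) u; first by left; right.
  right; apply: (leq_trans Aw); apply: N_nd => //.
  rewrite inverse_process_ge0/=; apply: inverse_process_le => //.
  exact: le_lt_trans uD.
have mA12 : measurable (A1 `|` A2) by exact: measurableU.
apply: (@le_trans _ _ (P ((A1 `|` A2) `|` A0))).
  have mU : measurable ((A1 `|` A2) `|` A0) by exact: measurableU.
  rewrite -(measureU0 mU mZ PZ); apply: le_measure; rewrite ?inE//.
  exact: measurableU.
apply: (le_trans (measureU2 _ _ _)) => //; rewrite EFinD; apply: leeD.
  apply: (le_trans (measureU2 _ _ _)) => //; rewrite EFinD; apply: leeD.
    exact: (gamma_process_gt_le alpha_gt0 p_gt0 G_gamma t0 pt1 u01).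
  exact: (stable_le_level_le D_stable (ltW r0) u0).
have PA0 : P A0 = (1 - expR (- (lambda * r)))%:E.
  exact: (poisson_process_jumped lambda_gt0 N_poisson).
rewrite -[leLHS]/(P A0) PA0 lee_fin.
by have := expR_ge1Dx (- (lambda * r)); lra.
Qed.

End time_changes.

(** * Comparison of the two bounds as t tends to 0 *)

Section small_times.
Context {R : realType}.
Implicit Types (t s c k y : R).

Lemma near0_powR_lt s c k : 0 < s -> 0 < k ->
  \forall t \near (0 : R)^'+, c * t `^ s < k.
Proof.
move=> s0 k0; apply: (@cvgr_lt _ _ _ _ _ 0) => //.
rewrite -[X in _ --> X](mulr0 c); apply: cvgM; first exact: cvg_cst.
exact: powR_cvg0.
Qed.

Lemma ln_le_powR t s : 0 < t -> 0 < s -> - ln t <= t `^ (- s) / s.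
Proof.
move=> t0 s0; rewrite ler_pdivlMr//.
have -> : - ln t * s = ln (t `^ (- s)) by rewrite ln_powR; ring.
by rewrite ltW// ln_sublinear// powR_gt0.
Qed.

(** From exp (y / 3) >= y / 3. The third power suffices below, where y is
    t^(- beta / 2): it yields t^(3 beta / 2), which is o(t^beta). *)
Lemma expRN_le_cube y : 0 < y -> expR (- y) <= 27 / y ^+ 3.
Proof.
move=> y0; rewrite expRN -[leRHS]invrK.
rewrite lef_pV2 ?posrE ?invr_gt0 ?divr_gt0 ?expR_gt0 ?exprn_gt0//.
have -> : (27 / y ^+ 3)^-1 = (y / 3) ^+ 3 by field; rewrite gt_eqF.
have -> : expR y = expR (y / 3) ^+ 3.
  by rewrite -expRM_natl; congr expR; field.
apply: lerXn2r; rewrite ?nnegrE ?expR_ge0 ?divr_ge0 ?(ltW y0)//.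
by have := expR_ge1Dx (y / 3); lra.
Qed.

(** The levels u = t^2 and r = t^(3 beta / 2) balance the three failures: r is
    o(t^beta), while u is so small that r u^(- beta) tends to infinity. In the
    bracket on the right every power of t is positive. *)
Lemma upper_bound_le (beta lambda a C t : R) :
  0 < beta < 1 -> 0 < C -> 0 < t < 1 ->
  C * t * (a - ln (t ^+ 2)) +
   expR (1 - t `^ (3 / 2 * beta) * (t ^+ 2)^-1 `^ beta) +
   lambda * t `^ (3 / 2 * beta) <=
  t `^ beta * (C * a * t `^ (1 - beta) +
    4 * C / (1 - beta) * t `^ ((1 - beta) / 2) +
    27 * expR 1 * t `^ (beta / 2) + lambda * t `^ (beta / 2)).
Proof.
move=> /andP[b0 b1] C0 /andP[t0 t1].
have tn : t != 0 by rewrite gt_eqF.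
have D u v : t `^ u * t `^ v = t `^ (u + v).
  by rewrite powRD// tn implybT.
have E1 : t `^ (3 / 2 * beta) = t `^ beta * t `^ (beta / 2).
  by rewrite D; congr powR; field.
have E2 : (t ^+ 2)^-1 `^ beta = t `^ (- (2 * beta)).
  rewrite -powR_invn ?ltW// -powRrM; congr powR; ring.
rewrite 3!(mulrDr (t `^ beta)); apply: lerD; last by rewrite E1 mulrCA.
apply: lerD; last first.
  rewrite E2 D expRD.
  have -> : 3 / 2 * beta + - (2 * beta) = - (beta / 2) by field.
  set y := t `^ (- (beta / 2)).
  have y0 : 0 < y by exact: powR_gt0.
  have H := expRN_le_cube y0.
  have -> : t `^ beta * (27 * expR 1 * t `^ (beta / 2)) =
      expR 1 * (27 / y ^+ 3).
    have -> : (y ^+ 3)^-1 = t `^ beta * t `^ (beta / 2).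
      rewrite -E1 /y -powR_mulrn ?powR_ge0// -powRrM -powRN.
      by congr powR; field.
    by ring.
  by rewrite ler_wpM2l ?expR_ge0.
rewrite -powR_mulrn ?(ltW t0)// ln_powR.
have -> : C * t * (a - 2%:R * ln t) = C * a * t + 2 * C * t * (- ln t) by ring.
have tt : t = t `^ beta * t `^ (1 - beta) by rewrite D subrKC powRr1 ?(ltW t0).
apply: lerD; first by rewrite {1}tt; lra.
(* half of the gap between the exponents 1 and beta absorbs the logarithm *)
pose s := (1 - beta) / 2.
have s0 : 0 < s by rewrite /s; lra.
have -> : t `^ beta * (4 * C / (1 - beta) * t `^ s) =
    2 * C * t * (t `^ (- s) / s).
  have ss : 1 - beta = s + s by rewrite /s; field.
  rewrite [X in 2 * C * X]tt ss -D powRN; field.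
  by rewrite !gt_eqF ?powR_gt0 ?addr_gt0.
by rewrite ler_wpM2l ?ln_le_powR// !mulr_ge0 ?ltW.
Qed.

End small_times.

Theorem lemma4p2 (R : realType) (d : measure_display) (T : measurableType d)
    (P : probability T R) (alpha p lambda beta : R)
    (N : R -> T -> nat) (G D : R -> T -> R)
    (beta01 : 0 < beta < 1) (alpha_gt0 : 0 < alpha) (p_gt0 : 0 < p)
    (lambda_gt0 : 0 < lambda)
    (N_poisson : poisson_process P lambda N)
    (G_gamma : gamma_subordinator P alpha p G)
    (D_stable : stable_subordinator P beta D)
    (NGE_independent : independent_systems P
       (tnth [tuple process_sigma N; process_sigma G;
                    process_sigma (inverse_process D)])) :
  ~ same_fdd P (time_change N (time_change G (inverse_process D)))
               (fractional_negative_binomial N G D).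
Proof.
move=> fdd.
(* one time and the event of at least one jump suffice *)
have one_dim t : 0 <= t ->
    P [set w | (0 < time_change N (time_change G (inverse_process D)) t w)%N] =
    P [set w | (0 < fractional_negative_binomial N G D t w)%N].
  move=> t0; pose B := [set v : 1.-tuple nat | (0 < tnth v ord0)%N].
  have mB : measurable B.
    have := @measurable_tnth _ _ 1 ord0 measurableT [set k | (0 < k)%N].
    by rewrite setTI; exact.
  have := fdd 1%N (fun=> t) (fun=> t0) B mB.
  rewrite /pushforward /B /preimage/=.
  by under eq_set do rewrite tnth_mktuple; under [in RHS]eq_set do
    rewrite tnth_mktuple.
pose c := alpha / (alpha + 1) * (expR (- (2 * alpha)) / 2).
pose k := (1 - expR (- lambda)) * (p / 4 * c) / 8.
have c0 : 0 < c by rewrite !mulr_gt0 ?invr_gt0 ?expR_gt0 ?addr_gt0.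
have k0 : 0 < k.
  have e0 : 0 < 1 - expR (- lambda).
    by rewrite subr_gt0 -[ltRHS]expR0 ltr_expR oppr_lt0.
  by rewrite divr_gt0// mulr_gt0// mulr_gt0// divr_gt0.
pose C := 2 * p * expR alpha.
have C0 : 0 < C by rewrite !mulr_gt0 ?expR_gt0.
have /andP[b0 b1] := beta01.
have k4 : 0 < k / 4 by rewrite divr_gt0.
have e1 : 0 < 1 - beta by lra.
have e2 : 0 < (1 - beta) / 2 by lra.
have e3 : 0 < beta / 2 by lra.
have : \forall t \near (0 : R)^'+, [/\ 0 < t < 1, p * t <= 1,
    p * (t `^ beta / 4) <= 1 &
    C * alpha^-1 * t `^ (1 - beta) +
    4 * C / (1 - beta) * t `^ ((1 - beta) / 2) +
    27 * expR 1 * t `^ (beta / 2) + lambda * t `^ (beta / 2) < k].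
  near=> t.
  have t0 : 0 < t by near: t; exact: nbhs_right_gt.
  have t1 : t < 1 by near: t; exact: nbhs_right_lt.
  split; first by rewrite t0.
  - have : p * t `^ 1 < 1 by near: t; exact: near0_powR_lt.
    by rewrite powRr1 ?(ltW t0)// => /ltW.
  - have : p / 4 * t `^ beta < 1 by near: t; exact: near0_powR_lt.
    lra.
  have H1 : C * alpha^-1 * t `^ (1 - beta) < k / 4.
    by near: t; exact: near0_powR_lt.
  have H2 : 4 * C / (1 - beta) * t `^ ((1 - beta) / 2) < k / 4.
    by near: t; exact: near0_powR_lt.
  have H3 : 27 * expR 1 * t `^ (beta / 2) < k / 4.
    by near: t; exact: near0_powR_lt.
  have H4 : lambda * t `^ (beta / 2) < k / 4.
    by near: t; exact: near0_powR_lt.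
  lra.
move=> /filter_ex[t [t01 pt1 pb1 bracket]].
have /andP[t0 t1] := t01.
have u01 : 0 < t ^+ 2 < 1 by rewrite exprn_gt0//= exprn_ilt1// ltW.
have r0 : 0 < t `^ (3 / 2 * beta) by exact: powR_gt0.
have lower := P_N_G_E_ge alpha_gt0 p_gt0 lambda_gt0 N_poisson G_gamma D_stable
  NGE_independent t0 pb1.
have upper := P_N_E_G_le alpha_gt0 p_gt0 lambda_gt0 N_poisson G_gamma D_stable
  t0 pt1 u01 r0.
rewrite (one_dim _ (ltW t0)) in lower.
have := le_trans lower upper; rewrite lee_fin leNgt => /negP; apply.
rewrite (_ : 2 * (p * t) * expR alpha = C * t); last by rewrite /C; ring.
apply: (le_lt_trans (upper_bound_le lambda alpha^-1 beta01 C0 t01)).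
rewrite -/c [ltRHS](_ : _ = t `^ beta * k); last by rewrite /k; field.
by rewrite ltr_pM2l ?powR_gt0.
Unshelve. all: end_near. Qed.
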